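(* Let $\mathcal U$ be a structurally complete variety of closure algebras containing the algebra $\mathsf B(\mathbf 2^2\oplus\mathbf 1)$, let $\mathcal W$ be a non-minimal variety of monadic algebras, and let $\mathcal V=\mathcal U\vee\mathcal W$ be their varietal join, with free algebra $\mathbf F$ of countably infinite rank. Then (1) $\mathcal V$ is almost structurally complete but not structurally complete; (2) there exists a $\mathcal V$-finitely presented unifiable algebra which does not embed into $\mathbf F$; (3) $\mathcal V$ does not have unitary (and hence does not have projective) unification.
   Context: A closure algebra is a Boolean algebra with a unary operation $\Diamond$ satisfying $\Diamond0=0$, $\Diamond(a\vee b)=\Diamond a\vee\Diamond b$, $a\le\Diamond a=\Diamond\Diamond a$; $\Box x=\neg\Diamond\neg x$. It is monadic if $\Diamond\Box a=\Box a$ for all $a$. A variety is minimal if it properly contains only the trivial variety. $\mathsf B(\mathbf 2^2\oplus\mathbf 1)$ is the closure algebra of all subsets of the poset $\{r,p,q\}$ with $r<p$, $r<q$ ($p,q$ incomparable), where $\Diamond X=\{y:\ y\le x\text{ for some }x\in X\}$. For a variety $\mathcal V$ with free algebras $\mathbf F$ (countably infinite rank) and $\mathbf F(k)$ (rank $k$): $\mathcal V$ is structurally complete if every quasi-identity true in $\mathbf F$ holds in $\mathcal V$; for a quasi-identity $q=(\forall\bar x)[\varphi\to\psi]$ let $q^*=(\forall\bar x)\neg\varphi$; $q$ true in $\mathbf F$ is active if $q^*$ fails in $\mathbf F$; $\mathcal V$ is almost structurally complete if every active quasi-identity holds in $\mathcal V$. An algebra is $\mathcal V$-finitely presented if isomorphic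 to $\mathbf F(k)/\theta$ with $\theta$ a congruence generated by finitely many pairs; it is unifiable if it admits a homomorphism (a unifier) into $\mathbf F$. $\mathcal V$ has unitary unification if every $\mathcal V$-finitely presented unifiable $\mathbf P$ has a most general unifier $u:\mathbf P\to\mathbf F$, i.e. one through which every unifier $v$ factors as $v=h\circ u$ for some endomorphism $h$ of $\mathbf F$; it has projective unification if every $\mathcal V$-finitely presented unifiable algebra is a retract of $\mathbf F$. *)

(* Defs.v *)
From Stdlib Require List.
From mathcomp Require Import all_boot.
From mathcomp Require Import boolp classical_sets.

Set Implicit Arguments.
Unset Strict Implicit.
Unset Printing Implicit Defensive.

Local Open Scope classical_set_scope.
Local Open Scope quotient_scope.

(** * Algebras in the signature of closure algebras *)

Record algebra := Algebra {
  carrier :> Type;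
  azero : carrier;
  aone : carrier;
  ameet : carrier -> carrier -> carrier;
  ajoin : carrier -> carrier -> carrier;
  acompl : carrier -> carrier;
  adia : carrier -> carrier }.

Arguments azero {a}.
Arguments aone {a}.

Definition ale (A : algebra) (x y : A) : Prop := ameet x y = x.

Definition abox (A : algebra) (x : A) : A := acompl (adia (acompl x)).

Record is_boolean_algebra (A : algebra) : Prop := IsBooleanAlgebra {
  ameetA : associative (@ameet A);
  ajoinA : associative (@ajoin A);
  ameetC : commutative (@ameet A);
  ajoinC : commutative (@ajoin A);
  ameetKU : forall x y : A, ameet x (ajoin x y) = x;
  ajoinKI : forall x y : A, ajoin x (ameet x y) = x;
  ameetUl : left_distributive (@ameet A) (@ajoin A);
  ameet1x : left_id aone (@ameet A);
  ajoin0x : left_id azero (@ajoin A);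
  ameetxC : forall x : A, ameet x (acompl x) = azero;
  ajoinxC : forall x : A, ajoin x (acompl x) = aone }.

Record is_closure_algebra (A : algebra) : Prop := IsClosureAlgebra {
  closure_boolean : is_boolean_algebra A;
  adia0 : adia azero = azero :> A;
  adiaU : {morph @adia A : x y / ajoin x y};
  ale_adia : forall x : A, ale x (adia x);
  adia_idem : forall x : A, adia (adia x) = adia x }.

Record is_monadic_algebra (A : algebra) : Prop := IsMonadicAlgebra {
  monadic_closure : is_closure_algebra A;
  adia_abox : forall x : A, adia (abox x) = abox x }.

Record is_hom (A B : algebra) (f : A -> B) : Prop := IsHom {
  hom0 : f azero = azero;
  hom1 : f aone = aone;
  homI : {morph f : x y / ameet x y};
  homU : {morph f : x y / ajoin x y};
  homC : {morph f : x / acompl x};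
  homD : {morph f : x / adia x} }.

Definition isomorphic (A B : algebra) : Prop :=
  exists2 f : A -> B, is_hom f & bijective f.

(** * Terms, identities and quasi-identities *)

Inductive term (X : Type) : Type :=
| TVar of X
| TZero
| TOne
| TMeet of term X & term X
| TJoin of term X & term X
| TCompl of term X
| TDia of term X.

Arguments TZero {X}.
Arguments TOne {X}.

Definition term_algebra (X : Type) : algebra :=
  @Algebra (term X) TZero TOne (@TMeet X) (@TJoin X) (@TCompl X) (@TDia X).

Fixpoint eval (X : Type) (A : algebra) (v : X -> A) (t : term X) : A :=
  match t with
  | TVar x => v x
  | TZero => azero
  | TOne => aone
  | TMeet s t => ameet (eval v s) (eval v t)
  | TJoin s t => ajoin (eval v s) (eval v t)
  | TCompl s => acompl (eval v s)
  | TDia s => adia (eval v s)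
  end.

Definition equation : Type := (term nat * term nat)%type.

Definition sat (A : algebra) (v : nat -> A) (e : equation) : Prop :=
  eval v e.1 = eval v e.2.

Definition validates (A : algebra) (e : equation) : Prop :=
  forall v : nat -> A, sat v e.

Record quasi_identity := QuasiIdentity {
  premises : seq equation;
  conclusion : equation }.

Definition sat_premises (A : algebra) (v : nat -> A) (q : quasi_identity) :=
  List.Forall (sat v) (premises q).

Definition qvalidates (A : algebra) (q : quasi_identity) : Prop :=
  forall v : nat -> A, sat_premises v q -> sat v (conclusion q).

(** The sentence q^* of a quasi-identity q. *)
Definition qstar (A : algebra) (q : quasi_identity) : Prop :=
  forall v : nat -> A, ~ sat_premises v q.

(** * Varieties *)

(** Classes of algebras are plain predicates: [set algebra] would force the
    universe of carriers strictly below that of [choiceType], ruling out the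
    quotients below as algebras. *)
Definition algebra_class : Type := algebra -> Prop.

Definition subclass (K L : algebra_class) : Prop := forall A, K A -> L A.

Definition proper_subclass (K L : algebra_class) : Prop :=
  subclass K L /\ ~ subclass L K.

Definition variety (K : algebra_class) : Prop :=
  exists E : equation -> Prop,
    forall A, K A <-> forall e, E e -> validates A e.

Definition trivial_variety : algebra_class := fun A => forall x y : A, x = y.

(** The trivial variety is itself minimal in this sense, so a non-minimal
    variety has a proper nontrivial subvariety. *)
Definition minimal_variety (K : algebra_class) : Prop :=
  forall L, variety L -> proper_subclass L K ->
    forall A, L A <-> trivial_variety A.

(** The smallest variety containing both [U] and [W]. *)
Definition varietal_join (U W : algebra_class) : algebra_class :=
  fun A => forall K, variety K -> subclass U K -> subclass W K -> K A.

(** * Congruences and quotients *)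

Record congruence (A : algebra) := Congruence {
  cong_rel :> A -> A -> Prop;
  cong_refl : forall x, cong_rel x x;
  cong_sym : forall x y, cong_rel x y -> cong_rel y x;
  cong_trans : forall y x z, cong_rel x y -> cong_rel y z -> cong_rel x z;
  cong_meet : forall x x' y y', cong_rel x x' -> cong_rel y y' ->
    cong_rel (ameet x y) (ameet x' y');
  cong_join : forall x x' y y', cong_rel x x' -> cong_rel y y' ->
    cong_rel (ajoin x y) (ajoin x' y');
  cong_compl : forall x x', cong_rel x x' -> cong_rel (acompl x) (acompl x');
  cong_dia : forall x x', cong_rel x x' -> cong_rel (adia x) (adia x') }.

Definition cong_relb (A : algebra) (c : congruence A) : rel {classic A} :=
  fun x y => `[< c x y >].

Lemma cong_relb_refl (A : algebra) (c : congruence A) :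
  reflexive (cong_relb c).
Proof. by move=> x; apply/asboolP; apply: cong_refl. Qed.

Lemma cong_relb_sym (A : algebra) (c : congruence A) :
  symmetric (cong_relb c).
Proof. by move=> x y; apply/asboolP/asboolP; apply: cong_sym. Qed.

Lemma cong_relb_trans (A : algebra) (c : congruence A) :
  transitive (cong_relb c).
Proof.
by move=> y x z /asboolP cxy /asboolP cyz; apply/asboolP; apply: cong_trans cyz.
Qed.

Definition cong_equiv (A : algebra) (c : congruence A) :=
  EquivRel (cong_relb c) (cong_relb_refl c) (cong_relb_sym c)
    (@cong_relb_trans A c).

Definition quotient (A : algebra) (c : congruence A) : algebra :=
  let Q := {eq_quot (cong_equiv c)} in
  @Algebra Q (\pi_Q azero) (\pi_Q aone)
    (fun x y => \pi_Q (@ameet A (repr x) (repr y)))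
    (fun x y => \pi_Q (@ajoin A (repr x) (repr y)))
    (fun x => \pi_Q (@acompl A (repr x)))
    (fun x => \pi_Q (@adia A (repr x))).

(** The congruence generated by the pairs in [s]. *)
Definition generated_congruence (A : algebra) (s : seq (A * A)) : congruence A.
Proof.
exists (fun x y => forall c : congruence A,
  List.Forall (fun p => c p.1 p.2) s -> c x y).
- by move=> x c _; apply: cong_refl.
- by move=> x y xy c cs; apply: cong_sym; apply: xy.
- by move=> y x z xy yz c cs; apply: (cong_trans (xy c cs) (yz c cs)).
- by move=> x x' y y' xx yy c cs; apply: cong_meet; [apply: xx | apply: yy].
- by move=> x x' y y' xx yy c cs; apply: cong_join; [apply: xx | apply: yy].
- by move=> x x' xx c cs; apply: cong_compl; apply: xx.
- by move=> x x' xx c cs; apply: cong_dia; apply: xx.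
Defined.

(** * Free algebras *)

Definition identity_congruence (V : algebra_class) (X : Type) :
  congruence (term_algebra X).
Proof.
exists (fun s t : term X =>
  forall A, V A -> forall v : X -> A, eval v s = eval v t).
- by [].
- by move=> s t st A VA v; rewrite st.
- by move=> t s u st tu A VA v; rewrite st // tu.
- by move=> s s' t t' ss tt A VA v /=; rewrite ss // tt.
- by move=> s s' t t' ss tt A VA v /=; rewrite ss // tt.
- by move=> s s' ss A VA v /=; rewrite ss.
- by move=> s s' ss A VA v /=; rewrite ss.
Defined.

(** The free algebra of [V] over the set [X] of free generators, as terms
    modulo the identities of [V]. *)
Definition free_algebra (V : algebra_class) (X : Type) : algebra :=
  quotient (identity_congruence V X).

(** * Structural completeness *)

Definition structurally_complete (V : algebra_class) : Prop :=
  forall q, qvalidates (free_algebra V nat) q ->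
    forall A, V A -> qvalidates A q.

Definition active (V : algebra_class) (q : quasi_identity) : Prop :=
  qvalidates (free_algebra V nat) q /\ ~ qstar (free_algebra V nat) q.

Definition almost_structurally_complete (V : algebra_class) : Prop :=
  forall q, active V q -> forall A, V A -> qvalidates A q.

(** * Unification *)

Definition finitely_presented (V : algebra_class) (P : algebra) : Prop :=
  exists (k : nat) (s : seq (free_algebra V 'I_k * free_algebra V 'I_k)),
    isomorphic P (quotient (generated_congruence s)).

Definition unifier (V : algebra_class) (P : algebra)
  (u : P -> free_algebra V nat) : Prop := is_hom u.

Definition unifiable (V : algebra_class) (P : algebra) : Prop :=
  exists u : P -> free_algebra V nat, unifier u.

Definition most_general_unifier (V : algebra_class) (P : algebra)
    (u : P -> free_algebra V nat) : Prop :=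
  unifier u /\
  forall v : P -> free_algebra V nat, unifier v ->
    exists2 h : free_algebra V nat -> free_algebra V nat,
      is_hom h & v = h \o u.

Definition unitary_unification (V : algebra_class) : Prop :=
  forall P, finitely_presented V P -> unifiable V P ->
    exists u : P -> free_algebra V nat, most_general_unifier u.

Definition embeds (A B : algebra) : Prop :=
  exists2 f : A -> B, is_hom f & injective f.

Definition retract (A B : algebra) : Prop :=
  exists (i : A -> B) (p : B -> A), [/\ is_hom i, is_hom p & cancel i p].

Definition projective_unification (V : algebra_class) : Prop :=
  forall P, finitely_presented V P -> unifiable V P ->
    retract P (free_algebra V nat).

(** * Closure algebras of posets *)

Definition poset_algebra (T : Type) (le : T -> T -> Prop) : algebra :=
  @Algebra (set T) set0 setT setI setU setC
    (fun X => [set y | exists2 x, X x & le y x]).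

(** The poset 2^2 (+) 1. *)
Inductive fork := fork_r | fork_p | fork_q.

Definition fork_le (x y : fork) : Prop := x = fork_r \/ x = y.

(* Main.v *)
(** In a closure algebra an open element g gives the congruence
    x ∧ g = y ∧ g, so a quasi-identity with premises p and conclusion s = t
    holds in a variety K iff the identity s ∧ □p = t ∧ □p does; hence a
    quasi-identity holds in U ∨ W as soon as it holds in U and in W.

    Let q be active, with premises satisfied by ε in the two-element algebra.
    If e is a term that is clopen in U and in W and lies below the premises
    of q at the terms σ, then (e ∧ σ) ∨ (¬e ∧ ε) satisfies the premises, so the
    conclusion at σ holds modulo e.  For U take a solution σ in the free
    algebra of U and e = □p(σ), which is 1 in U.  For W take variables σ and
    e = □(◇(◇z ∧ ¬z) ∧ p(σ)): it vanishes in U by structural completeness, and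
    in W it only ignores the part where ◇ is the identity, which is governed
    by the two-element algebra.  The rule ◇(◇z ∧ ¬z) = 1 => 0 = 1 is
    true in the free algebra but fails in W, so structural completeness fails.

    Since the fork is connected, a clopen element of the free algebra of U ∨ W
    is 0 or 1 in U.  The algebra P freely generated by a clopen x and
    a further y does not embed, because x ∧ ◇□y ≠ x ∧ □y and
    ¬x ∧ ◇□y ≠ ¬x ∧ □y in P; and no unifier of P is more general than both
    x = 0 and x = 1. *)
Require Import Defs.
From mathcomp Require Import all_boot.
From mathcomp Require Import boolp classical_sets.

Set Implicit Arguments.
Unset Strict Implicit.
Unset Printing Implicit Defensive.

Local Open Scope quotient_scope.

Local Notation "x ⊓ y" := (ameet x y) (at level 40, left associativity).
Local Notation "x ⊔ y" := (ajoin x y) (at level 50, left associativity).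
Local Notation "¬ x" := (acompl x) (at level 35, right associativity).
Local Notation "◇ x" := (adia x) (at level 35, right associativity).
Local Notation "□ x" := (abox x) (at level 35, right associativity).

(** * Boolean algebras *)

Lemma ameetxx (A : algebra) (BA : is_boolean_algebra A) (x : A) : x ⊓ x = x.
Proof. by rewrite -{2}(ajoinKI BA x x) (ameetKU BA). Qed.

Lemma ajoinxx (A : algebra) (BA : is_boolean_algebra A) (x : A) : x ⊔ x = x.
Proof. by rewrite -{2}(ameetKU BA x x) (ajoinKI BA). Qed.

Lemma ameet0x (A : algebra) (BA : is_boolean_algebra A) (x : A) :
  azero ⊓ x = azero.
Proof. by rewrite -{1}(ajoin0x BA x) (ameetKU BA). Qed.

Lemma ajoin1x (A : algebra) (BA : is_boolean_algebra A) (x : A) :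
  aone ⊔ x = aone.
Proof. by rewrite -{1}(ameet1x BA x) (ajoinKI BA). Qed.

Lemma ameetx0 (A : algebra) (BA : is_boolean_algebra A) (x : A) :
  x ⊓ azero = azero.
Proof. by rewrite (ameetC BA) ameet0x. Qed.

Lemma ameetx1 (A : algebra) (BA : is_boolean_algebra A) (x : A) :
  x ⊓ aone = x.
Proof. by rewrite (ameetC BA) (ameet1x BA). Qed.

Lemma ajoinx0 (A : algebra) (BA : is_boolean_algebra A) (x : A) :
  x ⊔ azero = x.
Proof. by rewrite (ajoinC BA) (ajoin0x BA). Qed.

Lemma ameetUr (A : algebra) (BA : is_boolean_algebra A) :
  right_distributive (@ameet A) (@ajoin A).
Proof. by move=> x y z; rewrite !(ameetC BA x) (ameetUl BA). Qed.

Lemma ameet_split (A : algebra) (BA : is_boolean_algebra A) (g x : A) :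
  x = x ⊓ g ⊔ x ⊓ ¬ g.
Proof. by rewrite -ameetUr // (ajoinxC BA) ameetx1. Qed.

Lemma acompl_unique (A : algebra) (BA : is_boolean_algebra A) (x y : A) :
  x ⊓ y = azero -> x ⊔ y = aone -> y = ¬ x.
Proof.
move=> xy0 xy1.
have ->: y = ¬ x ⊓ y.
  by rewrite -{1}(ameet1x BA y) -(ajoinxC BA x) (ameetUl BA) xy0 (ajoin0x BA).
rewrite -{2}(ameetx1 BA (¬ x)) -xy1 ameetUr // (ameetC BA _ x) (ameetxC BA).
by rewrite (ajoin0x BA).
Qed.

Lemma acomplK (A : algebra) (BA : is_boolean_algebra A) (x : A) : ¬ ¬ x = x.
Proof.
by apply/esym/acompl_unique=> //; rewrite 1?(ameetC BA) 1?(ajoinC BA)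
  ?(ameetxC BA) ?(ajoinxC BA).
Qed.

Lemma acompl0 (A : algebra) (BA : is_boolean_algebra A) : ¬ azero = aone :> A.
Proof. by apply/esym/acompl_unique; rewrite // ?ameet0x ?(ajoin0x BA). Qed.

Lemma acompl1 (A : algebra) (BA : is_boolean_algebra A) : ¬ aone = azero :> A.
Proof. by rewrite -acompl0 // acomplK. Qed.

(** The Boolean congruence of the principal filter of [g]; it respects [◇] once [g] is open. *)
Definition modeq (A : algebra) (g x y : A) : Prop := x ⊓ g = y ⊓ g.

Lemma modeq1 (A : algebra) (BA : is_boolean_algebra A) (x y : A) :
  modeq aone x y -> x = y.
Proof. by rewrite /modeq !ameetx1. Qed.

Lemma modeq_split (A : algebra) (BA : is_boolean_algebra A) (g x y : A) :
  modeq g x y -> modeq (¬ g) x y -> x = y.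
Proof.
by move=> xy xy'; rewrite (ameet_split BA g x) xy xy' -ameet_split.
Qed.

Lemma modeq_le (A : algebra) (BA : is_boolean_algebra A) (g h x y : A) :
  ale g h -> modeq h x y -> modeq g x y.
Proof.
by rewrite /ale /modeq => <- xy; rewrite (ameetC BA g) !(ameetA BA) xy.
Qed.

Lemma modeq_ale (A : algebra) (BA : is_boolean_algebra A) (g x : A) :
  ale g x <-> modeq g x aone.
Proof. by rewrite /ale /modeq (ameet1x BA) (ameetC BA). Qed.

Lemma modeq_degenerate (A : algebra) (BA : is_boolean_algebra A) (g : A) :
  modeq g azero aone -> g = azero.
Proof. by rewrite /modeq ameet0x // (ameet1x BA). Qed.

Lemma modeq_meet (A : algebra) (BA : is_boolean_algebra A) (g x x' y y' : A) :
  modeq g x x' -> modeq g y y' -> modeq g (x ⊓ y) (x' ⊓ y').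
Proof.
rewrite /modeq -!(ameetA BA) => xx ->.
by rewrite (ameetC BA y') !(ameetA BA) xx.
Qed.

Lemma modeq_join (A : algebra) (BA : is_boolean_algebra A) (g x x' y y' : A) :
  modeq g x x' -> modeq g y y' -> modeq g (x ⊔ y) (x' ⊔ y').
Proof. by rewrite /modeq !(ameetUl BA) => -> ->. Qed.

Lemma modeq_compl (A : algebra) (BA : is_boolean_algebra A) (g x x' : A) :
  modeq g x x' -> modeq g (¬ x) (¬ x').
Proof.
have le (a b : A) : modeq g a b -> ¬ a ⊓ g = ¬ a ⊓ ¬ b ⊓ g.
  move=> ab; rewrite {1}(ameet_split BA b (¬ a)) (ameetUl BA) -!(ameetA BA) -ab.
  by rewrite !(ameetA BA) (ameetC BA _ a) (ameetxC BA) ameet0x // (ajoin0x BA).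
move=> xx; rewrite /modeq (le _ _ xx) [RHS](le x' x) //.
by rewrite (ameetC BA (¬ x)).
Qed.

Definition aiff (A : algebra) (x y : A) : A := x ⊓ y ⊔ ¬ x ⊓ ¬ y.

Lemma aiffxx (A : algebra) (BA : is_boolean_algebra A) (x : A) :
  aiff x x = aone.
Proof. by rewrite /aiff !ameetxx // (ajoinxC BA). Qed.

(** [x] and [y] both meet [aiff x y] in [x ⊓ y]. This turns finitely many equations modulo [g] into
    one inequality. *)
Lemma ale_aiff (A : algebra) (BA : is_boolean_algebra A) (g x y : A) :
  ale g (aiff x y) <-> modeq g x y.
Proof.
split=> [gxy | xy]; last first.
  apply/(modeq_ale BA); rewrite -(aiffxx BA y).
  apply: modeq_join (modeq_meet _ _ _) (modeq_meet _ _ _) => //.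
  exact: modeq_compl.
have absorb (a b : A) : a ⊓ aiff a b = a ⊓ b.
  rewrite /aiff ameetUr // !(ameetA BA) (ameetxC BA) ameet0x // ajoinx0 //.
  by rewrite ameetxx.
have half (a b : A) : ale g (aiff a b) -> a ⊓ g = a ⊓ b ⊓ g.
  rewrite /ale => <-; rewrite (ameetC BA g) !(ameetA BA) absorb.
  rewrite [in RHS](ameetC BA a) -[in RHS](ameetA BA b a) absorb (ameetC BA a).
  by rewrite (ameetA BA) ameetxx.
rewrite /modeq (half x y) // (half y x) 1?(ameetC BA y) //.
by rewrite /aiff (ameetC BA y) (ameetC BA (¬ y)).
Qed.

(** * Closure algebras modulo an open element *)

Definition aopen (A : algebra) (g : A) : Prop := ◇ ¬ g = ¬ g.

Definition aclopen (A : algebra) (g : A) : Prop := ◇ g = g /\ aopen g.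

Lemma aopen1 (A : algebra) (CA : is_closure_algebra A) : aopen (aone : A).
Proof. by rewrite /aopen acompl1 ?(adia0 CA) //; apply: closure_boolean. Qed.

Lemma adia1 (A : algebra) (CA : is_closure_algebra A) : ◇ aone = aone :> A.
Proof.
have BA := closure_boolean CA.
by rewrite -[RHS](ale_adia CA) (ameet1x BA).
Qed.

Lemma aclopen1 (A : algebra) (CA : is_closure_algebra A) : aclopen (aone : A).
Proof. by split; [apply: adia1 | apply: aopen1]. Qed.

Lemma aopen_compl (A : algebra) (CA : is_closure_algebra A) (g : A) :
  ◇ g = g -> aopen (¬ g).
Proof. by rewrite /aopen acomplK //; apply: closure_boolean. Qed.

Lemma aclopen_compl (A : algebra) (CA : is_closure_algebra A) (g : A) :
  aclopen g -> aclopen (¬ g).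
Proof. by case=> g1 g2; split=> //; apply: aopen_compl. Qed.

Lemma aopen_box (A : algebra) (CA : is_closure_algebra A) (x : A) :
  aopen (□ x).
Proof. by apply: aopen_compl (adia_idem CA _). Qed.

Lemma ale_box (A : algebra) (CA : is_closure_algebra A) (x : A) :
  ale (□ x) x.
Proof.
have BA := closure_boolean CA; rewrite /ale {2}(ameet_split BA x (□ x)).
suff ->: □ x ⊓ ¬ x = azero by rewrite ajoinx0.
rewrite -(ale_adia CA (¬ x)) (ameetA BA) (ameetC BA) (ameetA BA) /abox.
by rewrite (ameetxC BA) ameet0x.
Qed.

Lemma abox1 (A : algebra) (CA : is_closure_algebra A) : □ aone = aone :> A.
Proof.
have BA := closure_boolean CA.
by rewrite /abox acompl1 // (adia0 CA) acompl0.
Qed.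

(** [¬ g] is closed, so the part of [x] outside [g] has its closure outside [g], and [◇ x ⊓ g]
    depends only on [x ⊓ g]. *)
Lemma modeq_dia (A : algebra) (CA : is_closure_algebra A) (g x x' : A) :
  aopen g -> modeq g x x' -> modeq g (◇ x) (◇ x').
Proof.
have BA := closure_boolean CA => og.
have le (a : A) : ◇ a ⊓ g = ◇ (a ⊓ g) ⊓ g.
  rewrite {1}(ameet_split BA g a) (adiaU CA) (ameetUl BA).
  suff ->: ◇ (a ⊓ ¬ g) ⊓ g = azero by rewrite ajoinx0.
  have: ◇ (a ⊓ ¬ g) ⊔ ¬ g = ¬ g.
    by rewrite -{2}og -(adiaU CA) (ajoinC BA) (ameetC BA) (ajoinKI BA) og.
  move/(congr1 (ameet g)); rewrite ameetUr // (ameetxC BA) ajoinx0 //.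
  by rewrite (ameetC BA).
by move=> xx; rewrite /modeq le xx -le.
Qed.

Definition open_congruence (A : algebra) (CA : is_closure_algebra A) (g : A)
  (og : aopen g) : congruence A.
Proof.
exists (modeq g) => //.
- by rewrite /modeq => y x z -> ->.
- exact: (modeq_meet (closure_boolean CA)).
- exact: (modeq_join (closure_boolean CA)).
- exact: (modeq_compl (closure_boolean CA)).
- by move=> x x'; apply: modeq_dia.
Defined.

(** * Homomorphisms, quotients and varieties *)

Lemma hom_comp (A B C : algebra) (f : A -> B) (g : B -> C) :
  is_hom f -> is_hom g -> is_hom (g \o f).
Proof.
case=> f0 f1 fI fU fC fD [g0 g1 gI gU gC gD]; split=> [||x y|x y|x|x] /=;
  by rewrite ?(f0, f1, fI, fU, fC, fD).
Qed.

Lemma eval_hom (X : Type) (A : algebra) (v : X -> A) :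
  @is_hom (term_algebra X) A (eval v).
Proof. by []. Qed.

Lemma hom_eval (X : Type) (A B : algebra) (f : A -> B) (v : X -> A)
    (t : term X) :
  is_hom f -> f (eval v t) = eval (f \o v) t.
Proof.
case=> f0 f1 fI fU fC fD.
by elim: t => //= [s <- t <-|s <- t <-|s <-|s <-]; rewrite ?(fI, fU, fC, fD).
Qed.

Lemma hom_abox (A B : algebra) (f : A -> B) (x : A) :
  is_hom f -> f (□ x) = □ f x.
Proof. by move=> hf; rewrite /abox (homC hf) (homD hf) (homC hf). Qed.

Lemma hom_sat (A B : algebra) (f : A -> B) (v : nat -> A) (e : equation) :
  is_hom f -> sat v e -> sat (f \o v) e.
Proof. by move=> hf; rewrite /sat -!(hom_eval v _ hf) => ->. Qed.

Lemma hom_sat_inj (A B : algebra) (f : A -> B) (v : nat -> A) (e : equation) :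
  is_hom f -> injective f -> sat (f \o v) e -> sat v e.
Proof. by move=> hf fI; rewrite /sat -!(hom_eval v _ hf) => /fI. Qed.

Lemma hom_sat_premises (A B : algebra) (f : A -> B) (v : nat -> A)
    (q : quasi_identity) :
  is_hom f -> sat_premises v q -> sat_premises (f \o v) q.
Proof. by move=> hf; apply: List.Forall_impl => e; apply: hom_sat. Qed.

Lemma piE (A : algebra) (c : congruence A) (x y : A) :
  \pi_{eq_quot (cong_equiv c)} x = \pi_{eq_quot (cong_equiv c)} y <-> c x y.
Proof.
split=> [/eqmodP /asboolP //|cxy]; apply/eqmodP; exact/asboolP.
Qed.

Definition qpi (A : algebra) (c : congruence A) (x : A) : quotient c :=
  \pi_{eq_quot (cong_equiv c)} x.

Definition qrepr (A : algebra) (c : congruence A) (x : quotient c) : A :=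
  repr (x : {eq_quot (cong_equiv c)}).

Lemma qpiE (A : algebra) (c : congruence A) (x y : A) :
  qpi c x = qpi c y <-> c x y.
Proof. exact: piE. Qed.

Lemma qreprK (A : algebra) (c : congruence A) : cancel (@qrepr A c) (@qpi A c).
Proof. by move=> x; apply: (@reprK _ {eq_quot (cong_equiv c)}). Qed.

Lemma qreprP (A : algebra) (c : congruence A) (x : A) :
  c (qrepr (qpi c x)) x.
Proof. by apply/qpiE; rewrite qreprK. Qed.

Lemma qpi_hom (A : algebra) (c : congruence A) : is_hom (qpi c).
Proof.
split=> // [x y|x y|x|x]; apply/esym/piE.
- by apply: cong_meet; apply: qreprP.
- by apply: cong_join; apply: qreprP.
- by apply: cong_compl; apply: qreprP.
- by apply: cong_dia; apply: qreprP.
Qed.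

Lemma quotient_hom (A B : algebra) (c : congruence A) (f : A -> B) :
  is_hom f -> (forall x y, c x y -> f x = f y) -> is_hom (f \o @qrepr A c).
Proof.
move=> hf fc.
have fr x : f (qrepr (qpi c x)) = f x by apply: fc; apply: qreprP.
have [f0 f1 fI fU fC fD] := hf.
by split=> [||x y|x y|x|x] /=; rewrite fr // ?(f0, f1, fI, fU, fC, fD).
Qed.

Definition kernel (A B : algebra) (f : A -> B) (hf : is_hom f) : congruence A.
Proof.
exists (fun x y => f x = f y) => //.
- by move=> y x z -> ->.
- by move=> x x' y y'; rewrite !(homI hf) => -> ->.
- by move=> x x' y y'; rewrite !(homU hf) => -> ->.
- by move=> x x'; rewrite !(homC hf) => ->.
- by move=> x x'; rewrite !(homD hf) => ->.
Defined.

Lemma variety_sub (K : algebra_class) (A B : algebra) (f : A -> B) :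
  variety K -> is_hom f -> injective f -> K B -> K A.
Proof.
case=> E KE hf fI /KE BE; apply/KE => e /BE eB v.
exact: hom_sat_inj fI (eB _).
Qed.

Lemma variety_quotient (K : algebra_class) (A : algebra) (c : congruence A) :
  variety K -> K A -> K (quotient c).
Proof.
case=> E KE /KE AE; apply/KE => e /AE eA v.
have ->: v = qpi c \o (@qrepr A c \o v) by apply/funext => i /=; rewrite qreprK.
by apply: hom_sat (eA _); apply: qpi_hom.
Qed.

Lemma variety_trivial (K : algebra_class) (A : algebra) :
  variety K -> trivial_variety A -> K A.
Proof. by case=> E KE tA; apply/KE => e _ v; apply: tA. Qed.

(** * Free algebras and finitely presented algebras *)

Definition free_var (V : algebra_class) (X : Type) (x : X) :
  free_algebra V X := qpi (identity_congruence V X) (TVar x).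

Definition free_term (V : algebra_class) (X : Type) (t : term X) :
  free_algebra V X := qpi (identity_congruence V X) t.

Definition rep (V : algebra_class) (X : Type) (x : free_algebra V X) : term X :=
  @qrepr (term_algebra X) _ x.

Lemma repK (V : algebra_class) (X : Type) :
  cancel (@rep V X) (@free_term V X).
Proof. exact: (@qreprK (term_algebra X)). Qed.

Lemma free_term_hom (V : algebra_class) (X : Type) :
  @is_hom (term_algebra X) _ (@free_term V X).
Proof. exact: qpi_hom. Qed.

Lemma free_termE (V : algebra_class) (X : Type) (s t : term X) :
  free_term V s = free_term V t <->
  forall A, V A -> forall v : X -> A, eval v s = eval v t.
Proof. exact: (@qpiE (term_algebra X)). Qed.

Lemma free_hom (V : algebra_class) (X : Type) (A : algebra) (v : X -> A) :
  V A -> is_hom (fun x : free_algebra V X => eval v (rep x)).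
Proof. by move=> VA; apply: quotient_hom (eval_hom v) _ => s t; apply. Qed.

Lemma eval_rep (V : algebra_class) (X : Type) (A : algebra) (v : X -> A)
    (t : term X) :
  V A -> eval v (rep (free_term V t)) = eval v t.
Proof.
by move=> VA; have /free_termE := repK (free_term V t); apply.
Qed.

Lemma eval_subst (X Y : Type) (A : algebra) (v : Y -> A) (σ : X -> term Y)
    (t : term X) :
  eval v (@eval X (term_algebra Y) σ t) = eval (eval v \o σ) t.
Proof.
exact: (@hom_eval X (term_algebra Y) A (eval v) σ t (eval_hom v)).
Qed.

Lemma eval_free (V : algebra_class) (X Y : Type) (v : X -> free_algebra V Y)
    (t : term X) :
  eval v t = free_term V (@eval X (term_algebra Y) (@rep V Y \o v) t).
Proof.
rewrite (hom_eval _ _ (free_term_hom V Y)); congr (eval _ t).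
by apply/funext => i /=; rewrite repK.
Qed.

Lemma sat_free (V : algebra_class) (v : nat -> free_algebra V nat)
    (e : equation) :
  sat v e <-> forall A, V A -> forall w : nat -> A,
                sat (eval w \o (@rep V nat \o v)) e.
Proof.
rewrite /sat !eval_free free_termE.
by split=> E A VA w; move: (E A VA w); rewrite !eval_subst.
Qed.

Lemma sat_premises_free (V : algebra_class) (v : nat -> free_algebra V nat)
    (q : quasi_identity) :
  sat_premises v q <-> forall A, V A -> forall w : nat -> A,
                sat_premises (eval w \o (@rep V nat \o v)) q.
Proof.
rewrite /sat_premises; split=> [vq A VA w|].
  by apply: List.Forall_impl vq => e /sat_free; apply.
elim: (premises q) => [|e s IHs] es; first by [].
constructor; last by apply: IHs => A VA w; move/List.Forall_cons_iff: (es A VA w) => [].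
by apply/sat_free => A VA w; move/List.Forall_cons_iff: (es A VA w) => [].
Qed.

(** A substitution [σ] solving the premises throughout [V] is a solution in the free algebra;
    passing to representatives alters it only by identities of [V]. *)
Lemma qvalidates_free (V : algebra_class) (q : quasi_identity)
    (σ : nat -> term nat) :
  qvalidates (free_algebra V nat) q ->
  (forall A, V A -> forall v : nat -> A, sat_premises (eval v \o σ) q) ->
  forall A, V A -> forall v : nat -> A, sat (eval v \o σ) (conclusion q).
Proof.
move=> Fq σq A VA v.
have E (B : algebra) (w : nat -> B) : V B ->
    eval w \o (@rep V nat \o (@free_term V nat \o σ)) = eval w \o σ.
  by move=> VB; apply/funext => i /=; rewrite eval_rep.
rewrite -E //; move: A VA v; apply/sat_free/Fq/sat_premises_free => A VA v.
by rewrite E //; apply: σq.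
Qed.

(** The generated congruence is the least one containing the pairs, so it lies in the kernel of the
    homomorphism that [w] induces on the free algebra. *)
Lemma presented_hom (V : algebra_class) (X : Type)
    (s : seq (free_algebra V X * free_algebra V X)) (B : algebra)
    (w : X -> B) :
  V B ->
  List.Forall (fun p => eval w (rep p.1) = eval w (rep p.2)) s ->
  exists2 f : quotient (generated_congruence s) -> B, is_hom f &
    forall t, f (qpi _ (free_term V t)) = eval w t.
Proof.
move=> VB ws; have hf := @free_hom V X B w VB.
have fc x y : generated_congruence s x y -> eval w (rep x) = eval w (rep y).
  by move/(_ (kernel hf)); apply.
exists (fun x => eval w (rep (qrepr x))); first exact: quotient_hom hf fc.
move=> t; rewrite -(@eval_rep V X B w t VB); apply: fc.
exact: (@qreprP (free_algebra V X)).
Qed.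

(** * The two-element algebra *)

Definition two : algebra := @Algebra bool false true andb orb negb id.

Lemma two_closure : is_closure_algebra two.
Proof.
by split; [split; repeat case | | repeat case | case |].
Qed.

Definition tobool (A : algebra) (b : bool) : A := if b then aone else azero.

Lemma tobool_hom (A : algebra) (CA : is_closure_algebra A) :
  @is_hom two A (@tobool A).
Proof.
have BA := closure_boolean CA.
split=> // [[] [] | [] [] | [] | []] /=;
  by rewrite ?(ameet1x BA, ameet0x BA, ajoin0x BA, ajoin1x BA, acompl0 BA,
               acompl1 BA, adia0 CA, adia1 CA).
Qed.

Lemma eval_tobool (X : Type) (A : algebra) (CA : is_closure_algebra A)
    (ε : X -> two) (t : term X) :
  eval (@tobool A \o ε) t = tobool A (eval ε t).
Proof. by rewrite (hom_eval _ _ (tobool_hom CA)). Qed.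

Lemma eval_tobool_term (X : Type) (A : algebra) (v : X -> A) (b : bool) :
  eval v (tobool (term_algebra X) b) = tobool A b.
Proof. by case: b. Qed.

Lemma tobool_modeq (A : algebra) (BA : is_boolean_algebra A) (g : A)
    (a b : bool) :
  g <> azero -> modeq g (tobool A a) (tobool A b) -> a = b.
Proof.
move=> g0; case: a b => [] [] //=; last by move/(modeq_degenerate BA).
by move/esym/(modeq_degenerate BA).
Qed.

Lemma two_in (K : algebra_class) (A : algebra) (CA : is_closure_algebra A) :
  variety K -> K A -> aone <> azero :> A -> K two.
Proof.
move=> vK KA A10; apply: variety_sub (tobool_hom CA) _ KA => //.
by case=> [] [] // /esym // /esym.
Qed.

(** * Quasi-identities as identities *)

Definition premise_term (q : quasi_identity) : term nat :=
  foldr (fun e t => TMeet (@aiff (term_algebra nat) e.1 e.2) t) TOne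
    (premises q).

Lemma ale_meet (A : algebra) (BA : is_boolean_algebra A) (g x y : A) :
  ale g (x ⊓ y) <-> ale g x /\ ale g y.
Proof.
rewrite /ale (ameetA BA); split=> [gxy|[-> ->] //].
split; last by rewrite -{1}gxy -(ameetA BA) ameetxx.
by rewrite -{1}gxy (ameetC BA _ y) -(ameetA BA) -(ameetA BA g) ameetxx //
  (ameetC BA).
Qed.

Lemma ale_trans (A : algebra) (BA : is_boolean_algebra A) (y x z : A) :
  ale x y -> ale y z -> ale x z.
Proof. by rewrite /ale => <- yz; rewrite -(ameetA BA) yz. Qed.

Lemma ale0x (A : algebra) (BA : is_boolean_algebra A) (x : A) : ale azero x.
Proof. exact: ameet0x. Qed.

Lemma ale1x (A : algebra) (BA : is_boolean_algebra A) (x : A) :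
  ale aone x <-> x = aone.
Proof. by rewrite /ale (ameet1x BA). Qed.

Lemma ale_premise_term (A : algebra) (BA : is_boolean_algebra A) (g : A)
    (v : nat -> A) (q : quasi_identity) :
  ale g (eval v (premise_term q)) <->
  List.Forall (fun e => modeq g (eval v e.1) (eval v e.2)) (premises q).
Proof.
rewrite /premise_term; elim: (premises q) => [|e s IHs] /=.
  by split=> // _; apply: ameetx1.
rewrite ale_meet // List.Forall_cons_iff IHs.
by rewrite -(ale_aiff BA).
Qed.

Lemma sat_premisesE (A : algebra) (BA : is_boolean_algebra A)
    (v : nat -> A) (q : quasi_identity) :
  sat_premises v q <-> eval v (premise_term q) = aone.
Proof.
rewrite -(ale1x BA) ale_premise_term //; split; apply: List.Forall_impl => e.
  by rewrite /sat => ->.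
exact: modeq1.
Qed.

(** The quotient modulo the open [g] stays in [K]; there the premises hold outright, so [q] applies,
    and its conclusion lifts back to an equation modulo [g]. *)
Lemma qvalidates_modeq (K : algebra_class) (q : quasi_identity) :
  variety K -> (forall A, K A -> qvalidates A q) ->
  forall A, K A -> is_closure_algebra A -> forall (v : nat -> A) (g : A),
  aopen g -> ale g (eval v (premise_term q)) ->
  modeq g (eval v (conclusion q).1) (eval v (conclusion q).2).
Proof.
move=> vK Kq A KA CA v g og gq; set c := open_congruence CA og.
have hp := qpi_hom c.
have: sat (qpi c \o v) (conclusion q).
  apply: Kq; first exact: variety_quotient.
  move/(ale_premise_term (closure_boolean CA)): gq.
  apply: List.Forall_impl => e; rewrite /sat -!(hom_eval _ _ hp) => eq.
  exact/qpiE.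
by rewrite /sat -!(hom_eval _ _ hp) => /qpiE.
Qed.

(* The rule m = 1 => 0 = 1 holds vacuously in the free algebra. *)
Lemma structurally_complete_refute (K : algebra_class) (m : term nat) :
  variety K -> structurally_complete K -> K two ->
  (forall ε : nat -> two, eval ε m = false) ->
  forall A, K A -> is_closure_algebra A -> forall (v : nat -> A) (g : A),
  aopen g -> ale g (eval v m) -> g = azero.
Proof.
move=> vK scK K2 m0 A KA CA v g og gm; have BA := closure_boolean CA.
pose q := QuasiIdentity [:: (m, TOne)] (TZero, TOne).
apply: modeq_degenerate => //.
apply: (@qvalidates_modeq K q vK _ A KA CA v g og).
  apply: scK => w /sat_premises_free /(_ _ K2 (fun=> false)) wq.
  by have /List.Forall_cons_iff [] := wq; rewrite /sat m0.
apply/ale_premise_term => //; constructor=> //=.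
exact/(modeq_ale BA).
Qed.

(** * Varietal joins *)

Lemma varietal_joinl (U W : algebra_class) : subclass U (varietal_join U W).
Proof. by move=> A UA K _ UK _; apply: UK. Qed.

Lemma varietal_joinr (U W : algebra_class) : subclass W (varietal_join U W).
Proof. by move=> A WA K _ _; apply. Qed.

Lemma varietal_join_variety (U W : algebra_class) :
  variety (varietal_join U W).
Proof.
exists (fun e => forall A, varietal_join U W A -> validates A e) => A.
split=> [VA e|AE K vK UK WK]; first exact.
have [E KE] := vK; apply/KE => e Ee; apply: AE => B VB.
by move/KE: (VB K vK UK WK) => BE; apply: BE.
Qed.

(** The models of the single equation [e] form a variety containing [U] and [W], hence their
    join. *)
Lemma varietal_join_validates (U W : algebra_class) (e : equation) :
  (forall A, U A \/ W A -> validates A e) ->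
  forall A, varietal_join U W A -> validates A e.
Proof.
move=> Ue A /(_ (fun B => validates B e)); apply=> [|B UB|B WB];
  [|by apply: Ue; left|by apply: Ue; right].
exists (eq e) => B; split=> [Be _ <- //|]; exact.
Qed.

Lemma varietal_join_premises (U W : algebra_class) (q : quasi_identity)
    (σ : nat -> term nat) :
  (forall A, U A \/ W A -> forall v : nat -> A, sat_premises (eval v \o σ) q) ->
  forall A, varietal_join U W A ->
  forall v : nat -> A, sat_premises (eval v \o σ) q.
Proof.
move=> UWq A VA v; apply/List.Forall_forall => e qe.
pose sub (t : term nat) : term nat := @eval nat (term_algebra nat) σ t.
have: validates A (sub e.1, sub e.2).
  apply: varietal_join_validates VA => B UWB w.
  have /List.Forall_forall /(_ e qe) := UWq B UWB w.
  by rewrite /sat /sub /= !eval_subst.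
by move/(_ v); rewrite /sat /sub /= !eval_subst.
Qed.

Lemma closure_algebra_variety : variety is_closure_algebra.
Proof.
pose x : term nat := TVar 0; pose y : term nat := TVar 1.
pose z : term nat := TVar 2.
pose E : seq equation :=
 [:: (TMeet x (TMeet y z), TMeet (TMeet x y) z);
     (TJoin x (TJoin y z), TJoin (TJoin x y) z);
     (TMeet x y, TMeet y x);
     (TJoin x y, TJoin y x);
     (TMeet x (TJoin x y), x);
     (TJoin x (TMeet x y), x);
     (TMeet (TJoin x y) z, TJoin (TMeet x z) (TMeet y z));
     (TMeet TOne x, x);
     (TJoin TZero x, x);
     (TMeet x (TCompl x), TZero);
     (TJoin x (TCompl x), TOne);
     (TDia TZero, TZero);
     (TDia (TJoin x y), TJoin (TDia x) (TDia y));
     (TMeet x (TDia x), x);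
     (TDia (TDia x), TDia x)].
exists (fun e => List.In e E) => A; split=> [[BA d0 dU le di] | AE].
  move=> e /= H v; move: H; do ![case=> [<- |]]; rewrite /sat //=;
    by [apply: (ameetA BA) | apply: (ajoinA BA) | apply: (ameetC BA)
       | apply: (ajoinC BA) | apply: (ameetKU BA) | apply: (ajoinKI BA)
       | apply: (ameetUl BA) | apply: (ameet1x BA) | apply: (ajoin0x BA)
       | apply: (ameetxC BA) | apply: (ajoinxC BA) | apply: dU | apply: le
       | apply: di].
have S k (a b c : A) : (k < 15) ->
    sat (fun i => nth azero [:: a; b; c] i) (List.nth k E (TZero, TZero)).
  by move=> /ltP k15; apply/AE/List.nth_In.
split; last by move=> a; apply: (S 14 a a a).
- split=> [a b c|a b c|a b|a b|a b|a b|a b c|a|a|a|a].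
  + exact: (S 0 a b c).
  + exact: (S 1 a b c).
  + exact: (S 2 a b b).
  + exact: (S 3 a b b).
  + exact: (S 4 a b b).
  + exact: (S 5 a b b).
  + exact: (S 6 a b c).
  + exact: (S 7 a a a).
  + exact: (S 8 a a a).
  + exact: (S 9 a a a).
  + exact: (S 10 a a a).
- exact: (S 11 azero azero azero).
- by move=> a b; apply: (S 12 a b b).
- by move=> a; apply: (S 13 a a a).
Qed.

(** * Discrete closure algebras *)

Lemma modeq_eval (A : algebra) (CA : is_closure_algebra A) (X : Type) (g : A)
    (v w : X -> A) (t : term X) :
  aopen g -> (forall i, modeq g (v i) (w i)) ->
  modeq g (eval v t) (eval w t).
Proof.
have BA := closure_boolean CA.
move=> og vw; elim: t => //= *; try by [].
- exact: modeq_meet.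
- exact: modeq_join.
- exact: modeq_compl.
- exact: modeq_dia.
Qed.

Fixpoint term_bound (t : term nat) : nat :=
  match t with
  | TVar i => i.+1
  | TZero | TOne => 0
  | TMeet s t | TJoin s t => maxn (term_bound s) (term_bound t)
  | TCompl s | TDia s => term_bound s
  end.

Lemma eval_bound (A : algebra) (v w : nat -> A) (t : term nat) (N : nat) :
  term_bound t <= N -> (forall i, i < N -> v i = w i) -> eval v t = eval w t.
Proof.
move=> tN vw; elim: t tN => //= [s IHs t IHt|s IHs t IHt|s IHs|s IHs].
- by rewrite geq_max => /andP[/IHs -> /IHt ->].
- by rewrite geq_max => /andP[/IHs -> /IHt ->].
- by move=> /IHs ->.
- by move=> /IHs ->.
Qed.

(* A nonzero element can be shrunk so as to decide any finite number of
   variables; this replaces an ultrafilter. *)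
Lemma discrete_eval_two (D : algebra) (CD : is_closure_algebra D)
    (v : nat -> D) (t : term nat) :
  (forall x : D, ◇ x = x) -> eval v t <> azero ->
  exists ε : nat -> two, eval ε t = true.
Proof.
have BD := closure_boolean CD => discr vt0.
have decide N : exists b : D, [/\ b <> azero, ale b (eval v t) &
    exists ε : nat -> two, forall i, i < N -> modeq b (v i) (tobool D (ε i))].
  elim: N => [|N [b [b0 bt [ε bε]]]].
    by exists (eval v t); split; [|apply: ameetxx|exists (fun=> false)].
  (* A nonzero [b] meets [v N] or its complement in a nonzero element, which decides variable
     [N]. *)
  have [x [c [xc0 xcN]]] : exists x (c : bool), b ⊓ x <> azero /\
      modeq x (v N) (tobool D c).
    have [bv|bv] := pselect (b ⊓ v N = azero); last first.
      by exists (v N), true; split=> //; rewrite /modeq /= ameetxx // (ameet1x BD).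
    exists (¬ v N), false; split; last by rewrite /modeq /= (ameetxC BD) ameet0x.
    by move=> bnv; apply: b0; rewrite (ameet_split BD (v N) b) bv bnv ajoinxx.
  have bxb : ale (b ⊓ x) b.
    by rewrite /ale (ameetC BD) (ameetA BD) ameetxx.
  have bxx : ale (b ⊓ x) x by rewrite /ale -(ameetA BD) ameetxx.
  exists (b ⊓ x); split=> //; first exact: ale_trans bt.
  exists (fun i => if i < N then ε i else c) => i.
  rewrite ltnS leq_eqVlt => /orP[/eqP ->|iN].
    by rewrite ltnn; apply: modeq_le xcN.
  by rewrite iN; apply: modeq_le (bε i iN).
have [b [b0 bt [ε bε]]] := decide (term_bound t).
exists ε; case E: (eval ε t) => //; case: b0.
(* Only the variables below the bound are decided; the others are reset to the values of [ε], which
   [t] does not see. *)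
pose w i := if i < term_bound t then v i else tobool D (ε i).
have: modeq b (eval w t) (eval (@tobool D \o ε) t).
  apply: modeq_eval => [//||i]; first exact: discr.
  by rewrite /w; case: ifP => // iN; apply: bε.
rewrite eval_tobool // E.
rewrite (@eval_bound D w v t _ (leqnn _)) => [|i iN]; last by rewrite /w iN.
by move=> bt0; apply: modeq_degenerate => //; rewrite /modeq -bt0; apply/modeq_ale.
Qed.

(** A counterexample in [D] makes the meet of the premises with the negated conclusion nonzero, and
    [discrete_eval_two] turns this into a counterexample in [two]. *)
Lemma qvalidates_discrete (D : algebra) (CD : is_closure_algebra D)
    (q : quasi_identity) :
  (forall x : D, ◇ x = x) -> qvalidates two q -> qvalidates D q.
Proof.
have BD := closure_boolean CD; have B2 := closure_boolean two_closure.
move=> discr q2 v /(sat_premisesE BD) vq.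
pose c := @aiff (term_algebra nat) (conclusion q).1 (conclusion q).2.
pose t : term nat := TMeet (premise_term q) (TCompl c).
suff t0 : eval v t = azero.
  apply: (modeq1 BD); apply/(ale_aiff BD)/(ale1x BD).
  by move: t0; rewrite /= vq (ameet1x BD) -[in RHS](acompl1 BD)
    => /(congr1 (@acompl D)); rewrite !acomplK.
apply/notP => /(discrete_eval_two CD discr) [ε].
move=> /= /andP[εq /negP]; apply.
by have := q2 ε (proj2 (sat_premisesE B2 _ _) εq); rewrite /sat /= => ->; case: (eval ε _).
Qed.

(** * Monadic algebras *)

Lemma monadic_adia_clopen (A : algebra) (MA : is_monadic_algebra A) (x : A) :
  aclopen (◇ x).
Proof.
have CA := monadic_closure MA; have BA := closure_boolean CA.
split; first exact: adia_idem.
by have := adia_abox MA (¬ x); rewrite /abox acomplK.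
Qed.

Lemma monadic_abox_clopen (A : algebra) (MA : is_monadic_algebra A) (x : A) :
  aclopen (□ x).
Proof.
by have CA := monadic_closure MA; apply/aclopen_compl/monadic_adia_clopen.
Qed.

Lemma aopen_abox (A : algebra) (CA : is_closure_algebra A) (g : A) :
  aopen g -> □ g = g.
Proof. by rewrite /abox => ->; apply/acomplK/closure_boolean. Qed.

(* The points of the closure of [z] outside [z]: in a monadic algebra this
   generates a clopen element vanishing exactly when [z] is closed, whereas it
   contains no nonzero open element in a structurally complete variety. *)
Definition boundary (A : algebra) (z : A) : A := ◇ (◇ z ⊓ ¬ z).

(** [◇ z ⊓ ¬ z] lies below its own closure, so it misses [g]. *)
Lemma boundary_eq0 (A : algebra) (CA : is_closure_algebra A) (g z : A) :
  boundary z ⊓ g = azero -> modeq g (◇ z) z.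
Proof.
have BA := closure_boolean CA => bg.
rewrite /modeq (ameet_split BA z (◇ z)) (ameetUl BA).
have ->: ◇ z ⊓ ¬ z ⊓ g = azero.
  rewrite -(ale_adia CA (◇ z ⊓ ¬ z)) -(ameetA BA) -/(boundary z) bg.
  exact: ameetx0.
by rewrite ajoinx0 // (ameetC BA _ z) (ale_adia CA).
Qed.

(** If every [◇] in [W] were the identity, all identities of [two] would hold throughout [W]. A
    nontrivial subvariety contains [two], so it would be all of [W], making [W] minimal. *)
Lemma non_minimal_closed (W : algebra_class) :
  variety W -> subclass W is_monadic_algebra -> ~ minimal_variety W ->
  exists A, W A /\ exists z : A, ◇ z <> z.
Proof.
move=> vW mW nminW; apply/notP => discr; apply: nminW => L vL [LW nWL] A.
have cW B : W B -> is_closure_algebra B by move/mW/monadic_closure.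
split=> [LA|]; last exact: variety_trivial.
apply/notP => ntA; apply: nWL => B WB; have BA := closure_boolean (cW _ (LW _ LA)).
have L2 : L two.
  apply: (two_in (cW _ (LW _ LA)) vL LA).
  move=> A10; apply: ntA => x y.
  by rewrite -(ameetx1 BA x) -(ameetx1 BA y) A10 !ameetx0.
have [E LE] := vL; apply/LE => e Ee v.
apply: (@qvalidates_discrete B (cW _ WB) (QuasiIdentity [::] e)) => //.
  by move=> x; apply/notP => xx; apply: discr; exists B; split=> //; exists x.
by move=> ε _; move/LE: L2; apply.
Qed.

(** * Active quasi-identities *)

Definition mix (e : term nat) (σ : nat -> term nat) (ε : nat -> two) (i : nat) :
  term nat :=
  TJoin (TMeet e (σ i)) (TMeet (TCompl e) (tobool (term_algebra nat) (ε i))).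

Lemma modeq_mix (A : algebra) (BA : is_boolean_algebra A) (g x y : A) :
  modeq g (g ⊓ x ⊔ ¬ g ⊓ y) x.
Proof.
have g1 : modeq g g aone by apply/(modeq_ale BA)/ameetxx.
have ng0 : modeq g (¬ g) azero by rewrite -(acompl1 BA); apply: modeq_compl.
rewrite -[X in modeq g _ X](ameet1x BA) -[X in modeq g _ X](ajoinx0 BA).
rewrite -(ameet0x BA y).
by apply: modeq_join; rewrite //; apply: modeq_meet.
Qed.

(** Clopenness makes both [e] and its complement open, so equality modulo either one is compatible
    with [◇] and passes through the term [t]. *)
Lemma eval_mix (A : algebra) (CA : is_closure_algebra A) (v : nat -> A)
    (e : term nat) (σ : nat -> term nat) (ε : nat -> two) (t : term nat) :
  aclopen (eval v e) ->
  modeq (eval v e) (eval (eval v \o mix e σ ε) t) (eval (eval v \o σ) t) /\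
  modeq (¬ eval v e) (eval (eval v \o mix e σ ε) t) (tobool A (eval ε t)).
Proof.
have BA := closure_boolean CA => ce; have [ce1 oe] := ce.
have [_ one] := aclopen_compl CA ce.
rewrite -eval_tobool //; split; apply: modeq_eval => //= i;
  rewrite eval_tobool_term; first exact: modeq_mix.
by rewrite -{2}(acomplK BA (eval v e)) (ajoinC BA); apply: modeq_mix.
Qed.

Lemma active_modeq (U W : algebra_class) (q : quasi_identity)
    (ε : nat -> two) (e : term nat) (σ : nat -> term nat) :
  subclass U is_closure_algebra -> subclass W is_closure_algebra ->
  qvalidates (free_algebra (varietal_join U W) nat) q -> sat_premises ε q ->
  (forall A, U A \/ W A -> forall v : nat -> A, aclopen (eval v e) /\
     ale (eval v e) (eval (eval v \o σ) (premise_term q))) ->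
  forall A, U A \/ W A -> forall v : nat -> A,
  modeq (eval v e) (eval (eval v \o σ) (conclusion q).1)
                   (eval (eval v \o σ) (conclusion q).2).
Proof.
move=> cU cW Fq εq eσ A UWA v.
have cUW B : U B \/ W B -> is_closure_algebra B by case=> [/cU|/cW].
have mixq B : varietal_join U W B -> forall w : nat -> B,
    sat_premises (eval w \o mix e σ ε) q.
  apply: varietal_join_premises => {}B UWB w; have CB := cUW B UWB.
  have BB := closure_boolean CB; have [ce eq] := eσ B UWB w.
  (* The premises hold on [e] because [e] lies below them at [σ], and off [e] because [ε] solves
     them. *)
  apply/(sat_premisesE BB)/(modeq_split BB (g := eval w e)).
    apply: etrans (proj1 (eval_mix CB σ ε _ ce)) _.
    exact/(modeq_ale BB).
  apply: etrans (proj2 (eval_mix CB σ ε _ ce)) _.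
  by have /(sat_premisesE (closure_boolean two_closure)) -> := εq.
have VA : varietal_join U W A.
  by case: UWA; [apply: varietal_joinl | apply: varietal_joinr].
have := qvalidates_free Fq mixq VA v; rewrite /sat => E.
have [ce _] := eσ A UWA v; have CA := cUW A UWA.
have [E1 _] := eval_mix CA σ ε (conclusion q).1 ce.
have [E2 _] := eval_mix CA σ ε (conclusion q).2 ce.
by rewrite /modeq -E1 -E2 E.
Qed.

Lemma eval_abox (X : Type) (A : algebra) (v : X -> A) (t : term X) :
  eval v (@abox (term_algebra X) t) = □ eval v t.
Proof. by []. Qed.

Lemma varietal_join_closure (U W : algebra_class) :
  subclass U is_closure_algebra -> subclass W is_closure_algebra ->
  subclass (varietal_join U W) is_closure_algebra.
Proof. by move=> cU cW A; apply=> //; apply: closure_algebra_variety. Qed.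

(** Structural completeness reduces the claim to the free algebra of [U], where a solution [w] is a
    substitution [σ]; as [e] is 1 in [U], nothing is lost modulo [e]. *)
Lemma active_left (U W : algebra_class) (q : quasi_identity) (ε : nat -> two) :
  subclass U is_closure_algebra -> subclass W is_monadic_algebra ->
  structurally_complete U ->
  qvalidates (free_algebra (varietal_join U W) nat) q -> sat_premises ε q ->
  forall A, U A -> qvalidates A q.
Proof.
move=> cU mW scU Fq εq; apply: scU => w /sat_premises_free wq.
pose σ := @rep U nat \o w.
pose e := @abox (term_algebra nat)
            (@eval nat (term_algebra nat) σ (premise_term q)).
have eE (A : algebra) (v : nat -> A) :
    eval v e = □ eval (eval v \o σ) (premise_term q).
  by rewrite /e eval_abox eval_subst.
have e1 (A : algebra) (v : nat -> A) : U A -> eval v e = aone.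
  move=> UA; have CA := cU A UA; rewrite eE.
  by have /(sat_premisesE (closure_boolean CA)) -> := wq A UA v; apply: abox1.
apply/sat_free => A UA v; have BA := closure_boolean (cU A UA).
apply/(modeq1 BA); rewrite -(e1 A v UA).
apply: (active_modeq cU (fun B WB => monadic_closure (mW B WB)) Fq εq);
  last by left.
move=> B [UB | WB] u.
  have CB := cU B UB; rewrite e1 //; split; first exact: aclopen1.
  by apply/(ale1x (closure_boolean CB))/(sat_premisesE (closure_boolean CB))/wq.
have MB := mW B WB; rewrite eE; split; first exact: monadic_abox_clopen.
exact/ale_box/monadic_closure.
Qed.

Lemma active_right (U W : algebra_class) (q : quasi_identity) (ε : nat -> two) :
  variety U -> subclass U is_closure_algebra -> structurally_complete U ->
  U two -> variety W -> subclass W is_monadic_algebra ->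
  (exists A, W A /\ exists z : A, ◇ z <> z) ->
  qvalidates (free_algebra (varietal_join U W) nat) q -> sat_premises ε q ->
  forall A, W A -> qvalidates A q.
Proof.
move=> vU cU scU U2 vW mW [A0 [WA0 [z0 z0P]]] Fq εq.
have cW B (WB : W B) := monadic_closure (mW B WB).
(* Variable 0 is reserved for the element whose boundary is taken; the variables of [q] are shifted
   up by one. *)
pose e0 : term nat := TMeet (@boundary (term_algebra nat) (TVar 0))
  (@eval nat (term_algebra nat) (fun i => TVar i.+1) (premise_term q)).
have e0E (A : algebra) (v : nat -> A) :
    eval v e0 = boundary (v 0) ⊓ eval (v \o S) (premise_term q).
  by rewrite /e0 /= eval_subst.
pose e := @abox (term_algebra nat) e0.
(* When [v] solves the premises, [e] evaluates to [boundary z], which is already open in a monadic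
   algebra. *)
have bound A (WA : W A) (v : nat -> A) (z : A) : sat_premises v q ->
    modeq (boundary z) (eval v (conclusion q).1) (eval v (conclusion q).2).
  have CA := cW A WA; have BA := closure_boolean CA.
  move/(sat_premisesE BA) => vq; pose w i := if i is j.+1 then v j else z.
  have we : eval w e = boundary z.
    rewrite eval_abox e0E /= (_ : w \o S = v) // vq ameetx1 //.
    by apply/aopen_abox/(proj2 (monadic_adia_clopen (mW A WA) _)).
  rewrite -we; apply: (active_modeq cU cW Fq εq (σ := fun i => TVar i.+1));
    last by right.
  move=> B [UB | WB] u.
    have CB := cU B UB; have BB := closure_boolean CB.
    (* In [two] every element is closed, so [e0] is constantly 0 there, and structural completeness
       makes its interior vanish in [U]. *)
    have ->: eval u e = azero; last first.
      rewrite -(acompl1 BB); split; first exact/aclopen_compl/aclopen1.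
      by rewrite acompl1 //; apply: ale0x.
    rewrite eval_abox.
    apply: (structurally_complete_refute (m := e0) vU scU U2 _ UB CB).
    - by move=> δ; rewrite e0E /boundary /=; case: (δ 0).
    - exact: aopen_box.
    - exact: ale_box.
  have CB := cW B WB; rewrite eval_abox.
  split; first exact: monadic_abox_clopen (mW B WB) _.
  by have := ale_box CB (eval u e0); rewrite {2}e0E => /(ale_meet (closure_boolean CB)) [].
(* [z0] is not closed, so its boundary is nonzero, and constants equal modulo a nonzero element are
   equal in [two]. *)
have q2 : qvalidates two q.
  move=> δ δq; have C0 := cW A0 WA0; have B0 := closure_boolean C0.
  have := bound A0 WA0 _ z0 (hom_sat_premises (tobool_hom C0) δq).
  rewrite !eval_tobool //; apply: tobool_modeq => // bz0.
  apply: z0P; apply/(modeq1 B0)/(boundary_eq0 C0).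
  by rewrite bz0 ameet0x.
move=> A WA v vq; have MA := mW A WA; have CA := cW A WA.
have BA := closure_boolean CA.
(* [c] is the truth value of the conclusion. By [bound], [¬ c] misses every boundary, hence so does
   the clopen [◇ ¬ c]. The quotient modulo [◇ ¬ c] is therefore discrete and satisfies [q], so
   [◇ ¬ c] lies below [c], which forces [¬ c] to vanish. *)
pose c := aiff (eval v (conclusion q).1) (eval v (conclusion q).2).
have [_ ob] := monadic_adia_clopen MA (¬ c).
have hp := qpi_hom (open_congruence CA ob).
have KD : W (quotient (open_congruence CA ob)) by apply: variety_quotient.
have discr (x : quotient (open_congruence CA ob)) : ◇ x = x.
  rewrite -(qreprK x) -(homD hp); apply/qpiE/(boundary_eq0 CA).
  set z := qrepr x; have [_ oz] := monadic_adia_clopen MA (◇ z ⊓ ¬ z).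
  have: modeq (boundary z) (¬ c) azero.
    rewrite -(acompl1 BA); apply: (modeq_compl BA).
    by apply/(modeq_ale BA)/(ale_aiff BA)/bound.
  move/(modeq_dia CA oz); rewrite (adia0 CA) /modeq ameet0x //.
  by rewrite (ameetC BA).
have: sat (qpi (open_congruence CA ob) \o v) (conclusion q).
  apply: (qvalidates_discrete (cW _ KD) discr q2).
  exact: hom_sat_premises.
rewrite /sat -!(hom_eval _ _ hp) => /qpiE /(ale_aiff BA) cc.
have nc : ale (¬ c) c by apply: ale_trans cc => //; apply: ale_adia.
apply: (modeq1 BA); apply/(ale_aiff BA)/(ale1x BA); rewrite -/c.
rewrite -(acomplK BA c) -(acompl0 BA); congr (¬ _).
by rewrite -nc (ameetC BA) (ameetxC BA).
Qed.

(** * Clopen elements of free algebras *)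

(** Nothing lies strictly above a point other than the root, so membership in [◇ X] there is
    membership in [X]. *)
Lemma fork_point_hom (x : fork) : x <> fork_r ->
  @is_hom (poset_algebra fork_le) two (fun X => `[< X x >]).
Proof.
move=> xr; split=> [||X Y|X Y|X|X] /=.
- exact/asboolP.
- exact/asboolP.
- exact: asbool_and.
- exact: asbool_or.
- exact: asbool_neg.
- apply: asbool_equiv_eq; split=> [[y Xy [//|->]]|Xx] //.
  by exists x => //; right.
Qed.

(* The least point of the fork forces a clopen set to agree at its two maximal
   points, where two arbitrary two-valued valuations can be placed. *)
Lemma fork_clopen_eval (t : term nat) :
  (forall v : nat -> poset_algebra fork_le, aclopen (eval v t)) ->
  forall ε δ : nat -> two, eval ε t = eval δ t.
Proof.
move=> ct ε δ.
pose v (i : nat) : poset_algebra fork_le :=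
  fun x => match x with
           | fork_r => False
           | fork_p => is_true (ε i : bool)
           | fork_q => is_true (δ i : bool)
           end.
have point (x : fork) : x <> fork_r ->
    `[< eval v t x >] = eval (fun i => `[< v i x >] : two) t.
  by move=> xr; rewrite (hom_eval v t (fork_point_hom xr)).
have -> : eval ε t = `[< eval v t fork_p >].
  rewrite point //; congr (eval _ t); apply/funext => i /=.
  by rewrite asboolb.
have -> : eval δ t = `[< eval v t fork_q >].
  rewrite point //; congr (eval _ t); apply/funext => i /=.
  by rewrite asboolb.
have [cX oX] := ct v; set X : set fork := eval v t in cX oX *.
(* A nonempty closed set contains the root, and an open set containing the root is everything. *)
have down (Y : set fork) x : adia (a := poset_algebra fork_le) Y = Y ->
    Y x -> Y fork_r.
  by move=> <- [y Yy xy]; exists y => //; left.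
have up x : X fork_r -> X x.
  by move=> Xr; apply: contrapT => /(down (~` X)%classic _ oX).
by apply: asbool_equiv_eq; split=> Xx; apply/up/(down X _ cX Xx).
Qed.

(** By the fork, all two-valued valuations give [t] the same value. If it is 0, structural
    completeness makes the open element [t] vanish in [U]; if it is 1, the same applies to its
    complement. *)
Lemma clopen_constant (U : algebra_class) (t : term nat) :
  variety U -> subclass U is_closure_algebra -> structurally_complete U ->
  U two -> U (poset_algebra fork_le) ->
  (forall A, U A -> forall v : nat -> A, aclopen (eval v t)) ->
  exists b, forall A, U A -> forall v : nat -> A, eval v t = tobool A b.
Proof.
move=> vU cU scU U2 Uf ct; have tE := fork_clopen_eval (ct _ Uf).
exists (eval (fun=> false : two) t) => A UA v.
have CA := cU A UA; have BA := closure_boolean CA.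
have [ct1 ot] := ct A UA v.
case E: (eval (fun=> false : two) t) => /=.
  rewrite -(acomplK BA (eval v t)) -(acompl0 BA); congr (¬ _).
  apply: (structurally_complete_refute (m := TCompl t) vU scU U2 _ UA CA (v := v)).
  - by move=> ε /=; rewrite (tE ε (fun=> false)) E.
  - exact: aopen_compl.
  - exact: ameetxx.
apply: (structurally_complete_refute (m := t) vU scU U2 _ UA CA (v := v) ot).
  by move=> ε; rewrite (tE ε (fun=> false)) E.
exact: ameetxx.
Qed.

Lemma hom_clopen (A B : algebra) (f : A -> B) (x : A) :
  is_hom f -> aclopen x -> aclopen (f x).
Proof.
by move=> hf [cx ox]; split; rewrite /aopen -?(homC hf) -(homD hf) ?cx ?ox.
Qed.

Lemma free_eq (U W : algebra_class)
    (x y : free_algebra (varietal_join U W) nat) :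
  (forall A, U A \/ W A -> forall v : nat -> A, eval v (rep x) = eval v (rep y)) ->
  x = y.
Proof.
move=> xy; rewrite -(repK x) -(repK y); apply/free_termE => A VA v.
exact: (@varietal_join_validates U W (rep x, rep y) xy A VA v).
Qed.

Lemma variety_free (V : algebra_class) (X : Type) :
  variety V -> V (free_algebra V X).
Proof.
case=> E VE; apply/VE => e Ee v; rewrite /sat !eval_free.
apply/free_termE => A /VE /(_ e Ee) Ae w; rewrite !eval_subst; exact: Ae.
Qed.

Lemma eval_TVar (X : Type) (t : term X) :
  @eval X (term_algebra X) (@TVar X) t = t.
Proof. by elim: t => //= [s -> t ->|s -> t ->|s ->|s ->]. Qed.

Lemma eval_free_var (V : algebra_class) (X : Type) (x : free_algebra V X) :
  eval (@free_var V X) (rep x) = x.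
Proof.
rewrite -[RHS]repK -[in RHS](eval_TVar (rep x)).
by rewrite (hom_eval _ _ (free_term_hom V X)).
Qed.

(** * An algebra generated by a clopen element and an arbitrary one *)

(** The pairs make generator 0 and its complement closed; generator 1 is left free. *)
Definition clopen_pairs (V : algebra_class) :
  seq (free_algebra V 'I_2 * free_algebra V 'I_2) :=
  let x : term 'I_2 := TVar ord0 in
  [:: (free_term V (TDia x), free_term V x);
      (free_term V (TDia (TCompl x)), free_term V (TCompl x))].

Definition clopen_algebra (V : algebra_class) : algebra :=
  quotient (generated_congruence (clopen_pairs V)).

Definition clopen_gen (V : algebra_class) : clopen_algebra V :=
  qpi _ (free_term V (TVar ord0)).

Definition other_gen (V : algebra_class) : clopen_algebra V :=
  qpi _ (free_term V (TVar ord_max)).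

Lemma clopen_algebra_fp (V : algebra_class) :
  finitely_presented V (clopen_algebra V).
Proof. by exists 2, (clopen_pairs V), id; [split | exists id]. Qed.

Lemma clopen_gen_clopen (V : algebra_class) : aclopen (clopen_gen V).
Proof.
have hp := qpi_hom (generated_congruence (clopen_pairs V)).
have hF := free_term_hom V 'I_2.
split; rewrite /aopen -?(homC hp) -(homD hp) -?(homC hF) -(homD hF);
  by apply/qpiE => c /List.Forall_cons_iff [? /List.Forall_cons_iff [? _]].
Qed.

(** The universal property, used both to build unifiers and to separate elements of the presented
    algebra. *)
Lemma clopen_algebra_hom (V : algebra_class) (B : algebra) (a c : B) :
  V B -> aclopen a ->
  exists f : clopen_algebra V -> B,
    [/\ is_hom f, f (clopen_gen V) = a & f (other_gen V) = c].
Proof.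
move=> VB [ca oa]; pose w (i : 'I_2) := if i == ord0 then a else c.
have [|f hf fE] := @presented_hom V 'I_2 (clopen_pairs V) B w VB.
  by do ![constructor]; rewrite /= !eval_rep.
by exists f; split; rewrite // /clopen_gen /other_gen fE.
Qed.

(** * Completeness, embeddings and unification in the join *)

Theorem theorem8p11 (U W : algebra_class)
    (U_variety : variety U)
    (U_closure : subclass U is_closure_algebra)
    (U_sc : structurally_complete U)
    (U_fork : U (poset_algebra fork_le))
    (W_variety : variety W)
    (W_monadic : subclass W is_monadic_algebra)
    (W_non_minimal : ~ minimal_variety W) :
  let V := varietal_join U W in
  let F := free_algebra V nat in
  (almost_structurally_complete V /\ ~ structurally_complete V) /\
  (exists P : algebra,
     [/\ finitely_presented V P, unifiable V P & ~ embeds P F]) /\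
  (~ unitary_unification V /\ ~ projective_unification V).
Proof.
move=> V F.
have W_closure : subclass W is_closure_algebra by move=> B /W_monadic [].
have vV : variety V := varietal_join_variety U W.
have cV : subclass V is_closure_algebra by apply: varietal_join_closure.
have UV : subclass U V := @varietal_joinl U W.
have WV : subclass W V := @varietal_joinr U W.
have fork10 : (aone : poset_algebra fork_le) <> azero.
  by move=> /(congr1 (fun X : set fork => X fork_r)) /= E; have : False by rewrite -E.
have U2 : U two := two_in (U_closure _ U_fork) U_variety U_fork fork10.
have closedW := non_minimal_closed W_variety W_monadic W_non_minimal.
have VF : V F := variety_free nat vV.
have CF : is_closure_algebra F := cV F VF.
have boolF (b : bool) : aclopen (tobool F b).
  case: b; first exact: aclopen1.
  by rewrite /tobool -(acompl1 (closure_boolean CF)); apply/aclopen_compl/aclopen1.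
have fpP := clopen_algebra_fp V.
have unP : unifiable V (clopen_algebra V).
  have [f [hf _ _]] := clopen_algebra_hom azero VF (boolF false).
  by exists f.
(* Every valuation into an algebra of [U] sends the image of the clopen generator to a clopen
   element, so the term representing that image is constant on [U]. *)
have const (f : clopen_algebra V -> F) : is_hom f -> exists b, forall A, U A ->
    forall v : nat -> A, eval v (rep (f (clopen_gen V))) = tobool A b.
  move=> hf; apply: clopen_constant => // A UA v.
  have hv := free_hom v (UV A UA).
  exact: (hom_clopen (hom_comp hf hv) (clopen_gen_clopen V)).
have not_unitary : ~ unitary_unification V.
  move=> /(_ _ fpP unP) [u [hu mgu]]; have [b ub] := const u hu.
  (* The unifier [v] sends the generator to the constant opposite to [b]. If it factored as
     [h \o u], following [h] with a map [k] into the fork would give the generator both values. *)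
  have [v [hv vE _]] := clopen_algebra_hom azero VF (boolF (~~ b)).
  have [h hh vhu] := mgu v hv.
  pose k (x : F) := eval (fun=> azero : poset_algebra fork_le) (rep x).
  have hk : is_hom k by apply: free_hom (UV _ U_fork).
  have := ub _ U_fork ((k \o h) \o @free_var V nat).
  rewrite -(hom_eval _ _ (hom_comp hh hk)) eval_free_var /=.
  have -> : h (u (clopen_gen V)) = tobool F (~~ b) by rewrite -vE vhu.
  by case: (b) => /=; rewrite ?(hom0 hk) ?(hom1 hk) => // /esym.
split; last split; last split=> //.
- split=> [q [Fq nFq] A VA | scV].
    have [w /sat_premises_free wq] : exists w : nat -> F, sat_premises w q.
      by apply: contrapT => nw; apply: nFq => w wq; apply: nw; exists w.
    have εq := wq _ (UV _ U2) (fun=> false).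
    have BA := closure_boolean (cV A VA).
    move=> v /(sat_premisesE BA) vq; apply: (modeq1 BA).
    pose p := @abox (term_algebra nat) (premise_term q).
    have <- : eval v p = aone by rewrite /p eval_abox vq; apply/abox1/cV.
    apply: (@varietal_join_validates U W
      (TMeet (conclusion q).1 p, TMeet (conclusion q).2 p) _ A VA v) => B UWB x.
    have CB : is_closure_algebra B by case: UWB => [/U_closure|/W_closure].
    rewrite /sat /=.
    case: UWB => [UB|WB].
      apply: (qvalidates_modeq U_variety _ UB CB (aopen_box CB _) (ale_box CB _)).
      exact: (active_left U_closure W_monadic U_sc Fq εq).
    apply: (qvalidates_modeq W_variety _ WB CB (aopen_box CB _) (ale_box CB _)).
    exact: (active_right U_variety U_closure U_sc U2 W_variety W_monadic closedW
              Fq εq).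
  (* If [V] were structurally complete, the rule with premise boundary of [z] equal to 1 would make
     every boundary in [W] vanish, whereas some [z] there is not closed. *)
  have [A [WA [z zP]]] := closedW; have CA := W_closure A WA; apply: zP.
  have [_ oz] := monadic_adia_clopen (W_monadic A WA) (◇ z ⊓ ¬ z).
  apply/(modeq1 (closure_boolean CA))/(boundary_eq0 CA).
  rewrite (ameetx1 (closure_boolean CA)).
  apply: (structurally_complete_refute (m := @boundary (term_algebra nat) (TVar 0))
            vV scV (UV _ U2) _ (WV _ WA) CA (v := fun=> z) oz).
    by move=> ε /=; case: (ε 0).
  exact: (ameetxx (closure_boolean CA)).
- exists (clopen_algebra V); split=> // -[f hf fI].
  have [b fb] := const f hf.
  (* [z] is whichever of the generator and its complement [f] makes vanish in [U]; the sides of [fz]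
     agree in [U] for that reason and in [W] by the monadic law. *)
  pose z := if b then ¬ clopen_gen V else clopen_gen V.
  have fz : z ⊓ ◇ □ other_gen V = z ⊓ □ other_gen V.
    apply/fI/free_eq => A UWA v.
    have VA : V A by case: UWA => [/UV|/WV].
    pose g x := eval v (rep (f x)).
    have hg : is_hom g := hom_comp hf (free_hom v VA).
    change (g (z ⊓ ◇ □ other_gen V) = g (z ⊓ □ other_gen V)).
    rewrite !(homI hg) (homD hg) (hom_abox _ hg).
    case: UWA => [UA|WA]; last by rewrite (adia_abox (W_monadic A WA)).
    have BA := closure_boolean (U_closure A UA).
    have ->: g z = azero; last by rewrite !ameet0x.
    have := fb A UA v; rewrite -/(g (clopen_gen V)) /z.
    by case: (b) => //= gc; rewrite (homC hg) gc acompl1.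
  (* On the fork [z] goes to 1 and the other generator to the open set [P]: the root lies in [◇ □ P]
     but not in [□ P]. *)
  pose P : poset_algebra fork_le := [set fork_p]%classic.
  have Cf := U_closure _ U_fork.
  have bf : aclopen (tobool (poset_algebra fork_le) (~~ b)).
    by apply: hom_clopen (tobool_hom Cf) _; split; case: (b).
  have [k [hk kc ko]] := clopen_algebra_hom P (UV _ U_fork) bf.
  have := congr1 k fz; rewrite !(homI hk) (homD hk) (hom_abox _ hk) ko.
  have -> : k z = aone.
    by rewrite /z; case: (b) kc => /= kc; rewrite ?(homC hk) kc ?acompl0 //;
      apply: closure_boolean.
  rewrite !(ameet1x (closure_boolean Cf)).
  move/(congr1 (fun X : set fork => X fork_r)) => E.
  have : (□ P : set fork) fork_r.
    rewrite -E; exists fork_p; last by left.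
    by case=> x xp [//|px]; apply: xp; rewrite -px.
  by apply; exists fork_r => //; right.
(* The embedding [i] of a retract is most general: a unifier [v] equals [(v \o p) \o i]. *)
- move=> proj; apply: not_unitary => Q fpQ /(proj Q fpQ) [i [p [hi hp ip]]].
  exists i; split=> // v hv; exists (v \o p); first exact: hom_comp hp hv.
  by apply/funext => x /=; rewrite ip.
Qed.
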